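(* Let $0<\alpha\le 1$ and let $x_0\in\left(\sqrt{\alpha/(1+\alpha)},1\right)$. Let $P$ be the period of the loop level set through $(x_0,\sqrt{1-x_0^2},0)$, let $\rho=P/2$, and let $\Lambda_P(t)=(a(t),b(t),0)$, $t\in(0,\rho]$, be the associated plane curve. Let $B_P$ be the rectangle in the plane $Z=0$ with vertices $(0,0,0)$, $(0,b(\rho),0)$, $(a(\rho),0,0)$, $(a(\rho),b(\rho),0)$. Then $\Lambda_P(t)$ lies in the interior (relative to the plane $Z=0$) of $B_P$ for every $t\in(0,\rho)$.
   Context: For $0<\alpha\le 1$, $G_\alpha$ is the Lie group $\mathbb{R}^3$ with product $(x,y,z)\ast(x',y',z')=(x'e^{z}+x,\;y'e^{-\alpha z}+y,\;z'+z)$, equipped with the left-invariant Riemannian metric $ds^2=e^{-2z}dx^2+e^{2\alpha z}dy^2+dz^2$. Its Lie algebra $\mathfrak{g}_\alpha$ is identified with $\mathbb{R}^3$ via the left-invariant orthonormal frame $X=e^{z}\partial_x,\ Y=e^{-\alpha z}\partial_y,\ Z=\partial_z$. $E:\mathfrak{g}_\alpha\to G_\alpha$ is the Riemannian exponential map at the identity. On the unit sphere $S(G_\alpha)\subset\mathfrak{g}_\alpha$ consider the vector field $\Sigma_\alpha(x,y,z)=(xz,-\alpha yz,\alpha y^2-x^2)$. For $x_0\in(\sqrt{\alpha/(1+\alpha)},1)$ the integral curve of $\Sigma_\alpha$ through $(x_0,\sqrt{1-x_0^2},0)$ is a closed curve (a loop level set of $|x|^\alpha y$) with finite minimal period $P$.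 Canonical parametrization: $p_t=(x(t),y(t),z(t))$ is the solution of the backward flow $x'=-xz,\ y'=\alpha yz,\ z'=x^2-\alpha y^2$ with $p_0=(x_0,\sqrt{1-x_0^2},0)$; with $\rho=P/2$, $p_t$ has all coordinates positive for $t\in(0,\rho)$ and $z(\rho)=0$. The integral curve of $\Sigma_\alpha$ that starts at $p_t$ ends at $(x(t),y(t),-z(t))$ after time $2t$; let $V_t=2t\,p_t\in\mathfrak{g}_\alpha$ be the corresponding vector. Define $\Lambda_P(t):=E(V_t)=(a(t),b(t),0)$ for $t\in(0,\rho]$. Equivalently, $a'=2x+az$, $b'=2y-\alpha bz$, $a(0)=b(0)=0$. *)

(* Defs.v *)
From Stdlib Require Import Reals Lra ClassicalEpsilon.
From Coquelicot Require Import Coquelicot.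
Open Scope R_scope.

Inductive axis : Set := ax | ay | az.

Definition sum_axis (f : axis -> R) : R := f ax + f ay + f az.

Record vec3 : Type := mk3 { cx : R; cy : R; cz : R }.

Definition coord (p : vec3) (i : axis) : R :=
  match i with ax => cx p | ay => cy p | az => cz p end.

Definition set_coord (p : vec3) (i : axis) (u : R) : vec3 :=
  match i with
  | ax => mk3 u (cy p) (cz p)
  | ay => mk3 (cx p) u (cz p)
  | az => mk3 (cx p) (cy p) u
  end.

Definition scal3 (c : R) (p : vec3) : vec3 := mk3 (c * cx p) (c * cy p) (c * cz p).
Definition opp3 (p : vec3) : vec3 := mk3 (- cx p) (- cy p) (- cz p).

Definition partial (i : axis) (f : vec3 -> R) (p : vec3) : R :=
  Derive (fun u => f (set_coord p i u)) (coord p i).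

(** * The group G_alpha, its left-invariant frame and its metric *)

Definition gmul (alpha : R) (p q : vec3) : vec3 :=
  mk3 (cx q * exp (cz p) + cx p) (cy q * exp (- alpha * cz p) + cy p) (cz q + cz p).

Definition gid : vec3 := mk3 0 0 0.

Lemma gmul_idl (alpha : R) (p : vec3) : gmul alpha gid p = p.
Proof.
  destruct p; unfold gmul, gid; simpl.
  rewrite Rmult_0_r, exp_0; f_equal; ring.
Qed.

Lemma gmul_idr (alpha : R) (p : vec3) : gmul alpha p gid = p.
Proof. destruct p; unfold gmul, gid; simpl; f_equal; ring. Qed.

(** The Lie algebra is identified with R^3 through X = e^z d/dx,
    Y = e^{-alpha z} d/dy, Z = d/dz: [frame alpha p v] is the tangent vector
    v_1 X + v_2 Y + v_3 Z at [p], in the coordinates (x, y, z). *)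
Definition frame (alpha : R) (p v : vec3) : vec3 :=
  mk3 (cx v * exp (cz p)) (cy v * exp (- alpha * cz p)) (cz v).

Lemma frame_left_invariant (alpha : R) (p v : vec3) (i : axis) :
  is_derive (fun h => coord (gmul alpha p (scal3 h v)) i) 0
            (coord (frame alpha p v) i).
Proof. destruct i; simpl; auto_derive; trivial; ring. Qed.

(** ds^2 = e^{-2z} dx^2 + e^{2 alpha z} dy^2 + dz^2. *)
Definition metric (alpha : R) (i j : axis) (p : vec3) : R :=
  match i, j with
  | ax, ax => exp (- 2 * cz p)
  | ay, ay => exp (2 * alpha * cz p)
  | az, az => 1
  | _, _ => 0
  end.

Definition metric_inv (alpha : R) (i j : axis) (p : vec3) : R :=
  match i, j with
  | ax, ax => / metric alpha ax ax p
  | ay, ay => / metric alpha ay ay p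
  | az, az => / metric alpha az az p
  | _, _ => 0
  end.

Definition delta (i j : axis) : R :=
  match i, j with
  | ax, ax | ay, ay | az, az => 1
  | _, _ => 0
  end.

Lemma metric_invE (alpha : R) (i j : axis) (p : vec3) :
  sum_axis (fun k => metric_inv alpha i k p * metric alpha k j p) = delta i j.
Proof.
  destruct i, j; unfold sum_axis; simpl; try ring;
    field; try apply Rgt_not_eq; try apply exp_pos.
Qed.

Lemma frame_orthonormal (alpha : R) (p v w : vec3) :
  sum_axis (fun i => sum_axis (fun j =>
    metric alpha i j p * coord (frame alpha p v) i * coord (frame alpha p w) j))
  = sum_axis (fun i => coord v i * coord w i).
Proof.
  unfold sum_axis; simpl.
  assert (Hx : exp (- 2 * cz p) * (exp (cz p) * exp (cz p)) = 1).
  { rewrite <- !exp_plus, <- exp_0; f_equal; ring. }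
  assert (Hy : exp (2 * alpha * cz p)
               * (exp (- alpha * cz p) * exp (- alpha * cz p)) = 1).
  { rewrite <- !exp_plus, <- exp_0; f_equal; ring. }
  transitivity
    (cx v * cx w * (exp (- 2 * cz p) * (exp (cz p) * exp (cz p)))
     + cy v * cy w * (exp (2 * alpha * cz p)
                      * (exp (- alpha * cz p) * exp (- alpha * cz p)))
     + cz v * cz w).
  - ring.
  - rewrite Hx, Hy; ring.
Qed.

(** * Geodesics and the Riemannian exponential map at the identity *)

(** Gamma^k_ij = 1/2 sum_l g^kl (d_i g_jl + d_j g_il - d_l g_ij). *)
Definition christoffel (alpha : R) (k i j : axis) (p : vec3) : R :=
  / 2 * sum_axis (fun l => metric_inv alpha k l p *
    (partial i (metric alpha j l) p + partial j (metric alpha i l) p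
     - partial l (metric alpha i j) p)).

Definition is_geodesic (alpha : R) (gamma : R -> vec3) : Prop :=
  forall (k : axis) (s : R),
    let c := fun (i : axis) (u : R) => coord (gamma u) i in
    ex_derive (c k) s /\
    ex_derive (Derive (c k)) s /\
    Derive (Derive (c k)) s
    + sum_axis (fun i => sum_axis (fun j =>
        christoffel alpha k i j (gamma s) * Derive (c i) s * Derive (c j) s)) = 0.

Definition has_velocity (gamma : R -> vec3) (s : R) (w : vec3) : Prop :=
  forall i : axis, is_derive (fun u => coord (gamma u) i) s (coord w i).

(** [riem_exp_rel alpha v q]: the geodesic that leaves the identity with initial
    velocity [v] is at [q] at time 1.  Geodesics can be taken on the whole of R
    because a left-invariant Riemannian metric is complete. *)
Definition riem_exp_rel (alpha : R) (v q : vec3) : Prop :=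
  exists gamma : R -> vec3,
    is_geodesic alpha gamma /\ gamma 0 = gid /\
    has_velocity gamma 0 (frame alpha gid v) /\ gamma 1 = q.

Definition riem_exp (alpha : R) (v : vec3) : vec3 :=
  epsilon (inhabits gid) (riem_exp_rel alpha v).

(** * The field Sigma_alpha, periods, and the curve Lambda_P *)

Definition Sigma (alpha : R) (v : vec3) : vec3 :=
  mk3 (cx v * cz v) (- alpha * cy v * cz v) (alpha * cy v ^ 2 - cx v ^ 2).

Definition is_integral_curve (F : vec3 -> vec3) (c : R -> vec3) : Prop :=
  forall s : R, has_velocity c s (F (c s)).

Definition is_period (c : R -> vec3) (P : R) : Prop :=
  0 < P /\ forall s : R, c (s + P) = c s.

Definition is_minimal_period (c : R -> vec3) (P : R) : Prop :=
  is_period c P /\ forall Q : R, is_period c Q -> P <= Q.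

Definition base_point (x0 : R) : vec3 := mk3 x0 (sqrt (1 - x0 ^ 2)) 0.

(** [p] is the canonical parametrization, i.e. the backward flow of Sigma_alpha
    from the base point; [2 t p_t] is the vector V_t. *)
Definition Lambda (alpha : R) (p : R -> vec3) (t : R) : vec3 :=
  riem_exp alpha (scal3 (2 * t) (p t)).

(** * Rectangles in the plane Z = 0 *)

(** The closed rectangle with vertices (0,0,0), (0,b,0), (a,0,0), (a,b,0). *)
Definition rectangle (a b : R) (q : vec3) : Prop :=
  exists s r : R, 0 <= s <= 1 /\ 0 <= r <= 1 /\ q = mk3 (s * a) (r * b) 0.

(** Topological interior relative to the plane Z = 0. *)
Definition plane_interior (B : vec3 -> Prop) (q : vec3) : Prop :=
  cz q = 0 /\ locally (cx q, cy q) (fun w : R * R => B (mk3 (fst w) (snd w) 0)).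

(* Main.v *)
(** Reversing time and reflecting in [z = 0] preserves integral curves of
    Sigma_alpha, so a zero of [z] at time [t > 0] makes [2 t] a period; by
    minimality of [P], [z > 0] on [(0, rho)].  Integrating the geodesic equation
    gives [a = F / x] and [b = G / y], where [F(t)] and [G(t)] are the integrals of
    [x ^ 2] and [y ^ 2] over [[-t, t]].  Both quotients increase strictly on
    [[0, rho]].  For [a] this is clear from [a' = 2 x + a z].  For [b],
    [y b' = 2 y ^ 2 - alpha z G] is positive at [0] and nondecreasing, because [y]
    is increasing and [z] is concave. *)

Require Import Defs.
From Stdlib Require Import Reals Lra ClassicalEpsilon.
From Coquelicot Require Import Coquelicot.
Open Scope R_scope.

(** * Calculus on the line: monotonicity, antiderivatives and rules for derivatives *)

Lemma nonneg_derivative_le (f f' : R -> R) (a b : R) :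
  a <= b -> (forall s, a <= s <= b -> is_derive f s (f' s)) ->
  (forall s, a < s < b -> 0 <= f' s) -> f a <= f b.
Proof.
  intros Hab Hd Hpos.
  destruct (Req_dec a b) as [<-|Hne]; [lra|].
  destruct (MVT_cor2 f f' a b) as [c [Hc Hcab]]; [lra| |].
  - intros s Hs; apply is_derive_Reals, Hd, Hs.
  - specialize (Hpos c Hcab); nra.
Qed.

Lemma pos_derivative_lt (f f' : R -> R) (a b : R) :
  a < b -> (forall s, a <= s <= b -> is_derive f s (f' s)) ->
  (forall s, a < s < b -> 0 < f' s) -> f a < f b.
Proof.
  intros Hab Hd Hpos.
  destruct (MVT_cor2 f f' a b) as [c [Hc Hcab]]; [lra| |].
  - intros s Hs; apply is_derive_Reals, Hd, Hs.
  - specialize (Hpos c Hcab); nra.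
Qed.

Lemma zero_derivative_const (f : R -> R) :
  (forall s, is_derive f s 0) -> forall s t, f s = f t.
Proof.
  intros Hd.
  assert (Hlt : forall s t, s < t -> f s = f t).
  { intros s t Hst; apply eq_is_derive; auto. }
  intros s t; destruct (Rtotal_order s t) as [H|[->|H]]; auto.
  symmetry; auto.
Qed.

Lemma same_derivative_eq (f g f' : R -> R) (s0 : R) :
  (forall s, is_derive f s (f' s)) -> (forall s, is_derive g s (f' s)) ->
  f s0 = g s0 -> forall s, f s = g s.
Proof.
  intros Hf Hg H0 s.
  assert (H : f s - g s = f s0 - g s0).
  { apply (zero_derivative_const (fun u => f u - g u)); intro u.
    evar_last; [apply (is_derive_minus f g); [apply Hf|apply Hg]|].
    unfold minus, plus, opp; simpl; ring. }
  lra.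
Qed.

Lemma is_derive_value (f : R -> R) (s l l' : R) :
  is_derive f s l -> l = l' -> is_derive f s l'.
Proof. intros H <-; exact H. Qed.

Lemma is_derive_comp_affine (f : R -> R) (k m s l : R) :
  is_derive f (k * s + m) l -> is_derive (fun u => f (k * u + m)) s (k * l).
Proof.
  intros H.
  apply (is_derive_comp f (fun u => k * u + m)); [exact H|].
  auto_derive; trivial; ring.
Qed.

Lemma is_derive_RInt_0 (f : R -> R) :
  (forall s, ex_derive f s) -> forall s, is_derive (fun u => RInt f 0 u) s (f s).
Proof.
  intros Hf s.
  assert (Hc : forall u, continuous f u).
  { intro u; apply (@ex_derive_continuous R_AbsRing R_NormedModule), Hf. }
  apply (@is_derive_RInt R_CompleteNormedModule f (fun u => RInt f 0 u) 0); auto.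
  apply filter_forall; intro u.
  apply (@RInt_correct R_CompleteNormedModule), (@ex_RInt_continuous R_CompleteNormedModule); auto.
Qed.

Lemma is_derive_const_minus_div (g : R -> R) (c d s l : R) :
  is_derive g s l -> is_derive (fun u => (c - g u) / d) s (- l / d).
Proof.
  intros H; auto_derive; [eexists; exact H|].
  replace (Derive _ s) with l by (symmetry; apply is_derive_unique, H).
  unfold Rdiv; ring.
Qed.

Lemma vec3_eq (p q : vec3) : (forall i, coord p i = coord q i) -> p = q.
Proof.
  intros H; generalize (H ax) (H ay) (H az); destruct p, q; simpl; congruence.
Qed.

(** * Integral curves of Sigma_alpha *)

Definition sq_norm (v : vec3) : R := cx v ^ 2 + cy v ^ 2 + cz v ^ 2.

Lemma integral_curve_components (F : vec3 -> vec3) (c : R -> vec3) :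
  is_integral_curve F c ->
  (forall s, is_derive (fun u => cx (c u)) s (cx (F (c s)))) /\
  (forall s, is_derive (fun u => cy (c u)) s (cy (F (c s)))) /\
  (forall s, is_derive (fun u => cz (c u)) s (cz (F (c s)))).
Proof.
  intros H; split; [|split]; intro s; [apply (H s ax)|apply (H s ay)|apply (H s az)].
Qed.

(** For expressions in functions whose derivatives are given by hypotheses
    [forall r, is_derive f r _]: these settle the differentiability conditions and evaluate the
    [Derive] terms, which leaves an algebraic identity. *)
Ltac derive_by :=
  auto_derive;
  [ repeat split; try (eexists; now eauto)
  | repeat match goal with
    | H : forall r, is_derive ?f r _ |- context [Derive ?g ?v] =>
        unify f g; rewrite (is_derive_unique g v _ (H v))
    end ].

(** [Sigma alpha v] is orthogonal to [v]: the terms [x^2 z], [- alpha y^2 z] and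
    [z (alpha y^2 - x^2)] cancel. *)
Lemma Sigma_sq_norm_const (alpha : R) (c : R -> vec3) :
  is_integral_curve (Sigma alpha) c ->
  forall s t, sq_norm (c s) = sq_norm (c t).
Proof.
  intros H; destruct (integral_curve_components _ _ H) as (Hx & Hy & Hz).
  simpl in Hx, Hy, Hz.
  apply (zero_derivative_const (fun s => sq_norm (c s))); intro s; unfold sq_norm.
  (* Named coordinates are real functions of one variable, the form in which [derive_by] recognises
     their derivatives. *)
  set (x := fun u => cx (c u)) in *; set (y := fun u => cy (c u)) in *;
    set (z := fun u => cz (c u)) in *.
  change (is_derive (fun u => x u ^ 2 + y u ^ 2 + z u ^ 2) s 0).
  derive_by.
  unfold x, y, z; ring.
Qed.

(** [D s * exp (- K * s)] is nonincreasing and [D s * exp (K * s)] is nondecreasing, so the zero at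
    [s0] propagates forward by the first and backward by the second. *)
Lemma gronwall_zero (D D' : R -> R) (K s0 : R) :
  (forall s, is_derive D s (D' s)) -> (forall s, 0 <= D s) ->
  (forall s, - (K * D s) <= D' s <= K * D s) ->
  D s0 = 0 -> forall s, D s = 0.
Proof.
  intros HD Hpos Hbound H0 s.
  apply Rle_antisym; [|apply Hpos].
  destruct (Rle_dec s0 s) as [Hs|Hs].
  - assert (H : - (D s0 * exp (- K * s0)) <= - (D s * exp (- K * s))).
    { apply (nonneg_derivative_le (fun u => - (D u * exp (- K * u)))
              (fun u => (K * D u - D' u) * exp (- K * u))); [exact Hs| |].
      - intros u _; derive_by; ring.
      - intros u _; apply Rmult_le_pos; [specialize (Hbound u); lra|].
        apply Rlt_le, exp_pos. }
    rewrite H0 in H; pose proof (exp_pos (- K * s)); nra.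
  - assert (H : D s * exp (K * s) <= D s0 * exp (K * s0)).
    { apply (nonneg_derivative_le (fun u => D u * exp (K * u))
              (fun u => (K * D u + D' u) * exp (K * u))); [lra| |].
      - intros u _; derive_by; ring.
      - intros u _; apply Rmult_le_pos; [specialize (Hbound u); lra|].
        apply Rlt_le, exp_pos. }
    rewrite H0 in H; pose proof (exp_pos (K * s)); nra.
Qed.

(* The cubic terms of the derivative of [|c - d|^2] cancel, so that it is a
   quadratic form in [c - d] with coefficients linear in [d]; these are bounded
   because [|d|] is constant. *)
Lemma Sigma_integral_curve_unique (alpha : R) (c d : R -> vec3) (s0 : R) :
  is_integral_curve (Sigma alpha) c -> is_integral_curve (Sigma alpha) d ->
  c s0 = d s0 -> forall s, c s = d s.
Proof.
  intros Hc Hd H0.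
  pose proof (Sigma_sq_norm_const alpha d Hd) as Hnorm.
  destruct (integral_curve_components _ _ Hc) as (Hx & Hy & Hz).
  destruct (integral_curve_components _ _ Hd) as (Hx' & Hy' & Hz').
  simpl in Hx, Hy, Hz, Hx', Hy', Hz'.
  (* This bounds every coordinate of [d], because [|u| <= 1 + u^2]. *)
  set (M := 1 + sq_norm (d s0)).
  assert (HM : forall s, Rabs (cx (d s)) <= M /\ Rabs (cy (d s)) <= M /\ Rabs (cz (d s)) <= M).
  { intro s; unfold M; rewrite (Hnorm s0 s); unfold sq_norm.
    repeat split; apply Rabs_le; nra. }
  assert (HM0 : 0 <= M) by (specialize (HM s0); pose proof (Rabs_pos (cx (d s0))); lra).
  assert (HD : forall s, (cx (c s) - cx (d s)) ^ 2 + (cy (c s) - cy (d s)) ^ 2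
                         + (cz (c s) - cz (d s)) ^ 2 = 0).
  { apply (gronwall_zero _ (fun s =>
      2 * (cz (d s) * (cx (c s) - cx (d s)) ^ 2
           - alpha * cz (d s) * (cy (c s) - cy (d s)) ^ 2
           - cx (d s) * (cx (c s) - cx (d s)) * (cz (c s) - cz (d s))
           + alpha * cy (d s) * (cy (c s) - cy (d s)) * (cz (c s) - cz (d s))))
      (* The bounds [T1] to [T4] below, added and doubled, put [4 M] on [dx^2], [4 M |alpha|] on
         [dy^2] and [2 M (1 + |alpha|)] on [dz^2]; this constant dominates all three. *)
      (4 * M * (1 + Rabs alpha)) s0).
    - intro s.
      set (x := fun u => cx (c u)) in *; set (y := fun u => cy (c u)) in *;
      set (z := fun u => cz (c u)) in *; set (x' := fun u => cx (d u)) in *;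
      set (y' := fun u => cy (d u)) in *; set (z' := fun u => cz (d u)) in *.
      change (is_derive (fun u => (x u - x' u) ^ 2 + (y u - y' u) ^ 2 + (z u - z' u) ^ 2) s
        (2 * (z' s * (x s - x' s) ^ 2 - alpha * z' s * (y s - y' s) ^ 2
              - x' s * (x s - x' s) * (z s - z' s)
              + alpha * y' s * (y s - y' s) * (z s - z' s)))).
      derive_by.
      unfold x, y, z, x', y', z'; ring.
    - intro s; repeat apply Rplus_le_le_0_compat; apply pow2_ge_0.
    - intro s; destruct (HM s) as (H1 & H2 & H3).
      set (dx := cx (c s) - cx (d s)); set (dy := cy (c s) - cy (d s));
      set (dz := cz (c s) - cz (d s)).
      apply Rabs_le_between.
      rewrite Rabs_mult, (Rabs_pos_eq 2) by lra.
      assert (Hxz : 2 * (Rabs dx * Rabs dz) <= dx ^ 2 + dz ^ 2).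
      { rewrite <- (pow2_abs dx), <- (pow2_abs dz).
        pose proof (pow2_ge_0 (Rabs dx - Rabs dz)); nra. }
      assert (Hyz : 2 * (Rabs dy * Rabs dz) <= dy ^ 2 + dz ^ 2).
      { rewrite <- (pow2_abs dy), <- (pow2_abs dz).
        pose proof (pow2_ge_0 (Rabs dy - Rabs dz)); nra. }
      assert (T1 : Rabs (cz (d s) * dx ^ 2) <= M * dx ^ 2).
      { rewrite Rabs_mult, (Rabs_pos_eq (dx ^ 2)) by apply pow2_ge_0.
        apply Rmult_le_compat_r; [apply pow2_ge_0|exact H3]. }
      assert (T2 : Rabs (alpha * cz (d s) * dy ^ 2) <= Rabs alpha * (M * dy ^ 2)).
      { rewrite !Rabs_mult, (Rabs_pos_eq (dy ^ 2)), Rmult_assoc by apply pow2_ge_0.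
        apply Rmult_le_compat_l; [apply Rabs_pos|].
        apply Rmult_le_compat_r; [apply pow2_ge_0|exact H3]. }
      assert (T3 : Rabs (cx (d s) * dx * dz) <= M * (dx ^ 2 + dz ^ 2)).
      { rewrite !Rabs_mult, Rmult_assoc.
        apply Rmult_le_compat; try apply Rabs_pos; auto.
        - apply Rmult_le_pos; apply Rabs_pos.
        - pose proof (pow2_ge_0 dx); pose proof (pow2_ge_0 dz); lra. }
      assert (T4 : Rabs (alpha * cy (d s) * dy * dz) <= Rabs alpha * (M * (dy ^ 2 + dz ^ 2))).
      { rewrite !Rabs_mult, !Rmult_assoc.
        apply Rmult_le_compat_l; [apply Rabs_pos|].
        apply Rmult_le_compat; try apply Rabs_pos; auto.
        - apply Rmult_le_pos; apply Rabs_pos.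
        - pose proof (pow2_ge_0 dy); pose proof (pow2_ge_0 dz); lra. }
      eapply Rle_trans.
      { apply Rmult_le_compat_l; [lra|].
        eapply Rle_trans; [apply Rabs_triang|].
        apply Rplus_le_compat; [|exact T4].
        eapply Rle_trans; [apply Rabs_triang|rewrite Rabs_Ropp].
        apply Rplus_le_compat; [|exact T3].
        eapply Rle_trans; [apply Rabs_triang|rewrite Rabs_Ropp].
        apply Rplus_le_compat; [exact T1|exact T2]. }
      pose proof (Rabs_pos alpha) as Ha.
      pose proof (Rmult_le_pos _ _ HM0 (pow2_ge_0 dx)).
      pose proof (Rmult_le_pos _ _ HM0 (pow2_ge_0 dy)).
      pose proof (Rmult_le_pos _ _ HM0 (pow2_ge_0 dz)).
      pose proof (Rmult_le_pos _ _ Ha (Rmult_le_pos _ _ HM0 (pow2_ge_0 dx))).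
      pose proof (Rmult_le_pos _ _ Ha (Rmult_le_pos _ _ HM0 (pow2_ge_0 dy))).
      pose proof (Rmult_le_pos _ _ Ha (Rmult_le_pos _ _ HM0 (pow2_ge_0 dz))).
      nra.
    - rewrite H0; ring. }
  intro s; specialize (HD s).
  apply vec3_eq; intro i; clear - HD.
  assert (H : (coord (c s) i - coord (d s) i) ^ 2 = 0).
  { pose proof (pow2_ge_0 (cx (c s) - cx (d s))).
    pose proof (pow2_ge_0 (cy (c s) - cy (d s))).
    pose proof (pow2_ge_0 (cz (c s) - cz (d s))).
    destruct i; simpl coord; lra. }
  apply Rminus_diag_uniq; nra.
Qed.

(** * Symmetries of the flow: scaling, reflection, time reversal *)

Lemma is_derive_rescale (f : R -> R) (k m s l l' : R) :
  is_derive f (k * s + m) l -> l' = k * (k * l) ->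
  is_derive (fun u => k * f (k * u + m)) s l'.
Proof.
  intros H ->.
  apply (is_derive_scal (fun u => f (k * u + m)) s k), is_derive_comp_affine, H.
Qed.

(** [Sigma] is homogeneous of degree two: one factor [k] comes from the change of speed, the other
    from scaling the point. *)
Lemma Sigma_curve_rescale (alpha : R) (c : R -> vec3) (k m : R) :
  is_integral_curve (Sigma alpha) c ->
  is_integral_curve (Sigma alpha) (fun s => scal3 k (c (k * s + m))).
Proof.
  intros H s i; destruct (integral_curve_components _ _ H) as (Hx & Hy & Hz).
  destruct i; simpl.
  - eapply (is_derive_rescale (fun u => cx (c u))); [apply Hx|simpl; ring].
  - eapply (is_derive_rescale (fun u => cy (c u))); [apply Hy|simpl; ring].
  - eapply (is_derive_rescale (fun u => cz (c u))); [apply Hz|simpl; ring].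
Qed.

Definition reflect (v : vec3) : vec3 := mk3 (cx v) (cy v) (- cz v).

(** Under [z -> - z] the first two components of [Sigma] change sign, which time reversal
    compensates; the third is even, and there the two sign changes cancel. *)
Lemma Sigma_curve_reflect (alpha : R) (c : R -> vec3) (m : R) :
  is_integral_curve (Sigma alpha) c ->
  is_integral_curve (Sigma alpha) (fun s => reflect (c (-1 * s + m))).
Proof.
  intros H s i; destruct (integral_curve_components _ _ H) as (Hx & Hy & Hz).
  destruct i; simpl.
  - eapply is_derive_value;
      [apply (is_derive_comp_affine (fun u => cx (c u))), Hx|simpl; ring].
  - eapply is_derive_value;
      [apply (is_derive_comp_affine (fun u => cy (c u))), Hy|simpl; ring].
  - eapply is_derive_value;
      [apply @is_derive_opp, (is_derive_comp_affine (fun u => cz (c u))), Hz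
      |unfold opp; simpl; ring].
Qed.

Lemma backward_curve_reverse (alpha : R) (p : R -> vec3) :
  is_integral_curve (fun v => opp3 (Sigma alpha v)) p ->
  is_integral_curve (Sigma alpha) (fun s => p (-1 * s + 0)).
Proof.
  intros H s i; destruct (integral_curve_components _ _ H) as (Hx & Hy & Hz).
  destruct i; simpl;
  [ eapply is_derive_value;
      [apply (is_derive_comp_affine (fun u => cx (p u))), Hx|simpl; ring]
  | eapply is_derive_value;
      [apply (is_derive_comp_affine (fun u => cy (p u))), Hy|simpl; ring]
  | eapply is_derive_value;
      [apply (is_derive_comp_affine (fun u => cz (p u))), Hz|simpl; ring] ].
Qed.

(** A point with [z = 0] is fixed by [reflect], so the curve and its reflected reversal about [m]
    agree at [m], hence everywhere by uniqueness. *)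
Lemma Sigma_curve_symmetric (alpha : R) (c : R -> vec3) (m : R) :
  is_integral_curve (Sigma alpha) c -> cz (c m) = 0 ->
  forall s, c (m + s) = reflect (c (m - s)).
Proof.
  intros Hc Hm s.
  rewrite (Sigma_integral_curve_unique alpha c
             (fun u => reflect (c (-1 * u + 2 * m))) m Hc
             (Sigma_curve_reflect alpha c (2 * m) Hc)).
  - do 2 f_equal; ring.
  - replace (-1 * m + 2 * m) with m by ring.
    unfold reflect; destruct (c m) as [u v w]; simpl in *; rewrite Hm; f_equal; ring.
Qed.

(* Composing the symmetries about two zeros of [z] gives a translation. *)
Lemma Sigma_curve_period (alpha : R) (c : R -> vec3) (t : R) :
  is_integral_curve (Sigma alpha) c -> cz (c 0) = 0 -> cz (c t) = 0 ->
  0 < t -> is_period c (2 * t).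
Proof.
  intros Hc H0 Ht Hpos; split; [lra|]; intro s.
  replace (s + 2 * t) with (t + (t + s)) by ring.
  rewrite (Sigma_curve_symmetric alpha c t Hc Ht).
  replace (t - (t + s)) with (0 - s) by ring.
  rewrite <- (Sigma_curve_symmetric alpha c 0 Hc H0).
  f_equal; ring.
Qed.

(** * Geodesics and their left-translated velocities *)

Lemma Derive_exp_linear (k u : R) : Derive (fun v => exp (k * v)) u = k * exp (k * u).
Proof. apply is_derive_unique; auto_derive; trivial; ring. Qed.

Lemma partial_metric (alpha : R) (i j k : axis) (p : vec3) :
  partial k (metric alpha i j) p =
  match i, j, k with
  | ax, ax, az => -2 * metric alpha ax ax p
  | ay, ay, az => 2 * alpha * metric alpha ay ay p
  | _, _, _ => 0
  end.
Proof.
  destruct i, j, k; unfold partial; simpl; try apply Derive_const;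
    rewrite Derive_exp_linear; ring.
Qed.

(** The quadratic term of the geodesic equation. The metric is diagonal and depends on [z] alone, so
    few symbols survive. *)
Lemma christoffel_sum (alpha : R) (k : axis) (p : vec3) (v : axis -> R) :
  sum_axis (fun i => sum_axis (fun j => christoffel alpha k i j p * v i * v j)) =
  match k with
  | ax => -2 * v ax * v az
  | ay => 2 * alpha * v ay * v az
  | az => metric alpha ax ax p * v ax ^ 2 - alpha * metric alpha ay ay p * v ay ^ 2
  end.
Proof.
  assert (Hx : exp (- 2 * cz p) <> 0) by apply Rgt_not_eq, exp_pos.
  assert (Hy : exp (2 * alpha * cz p) <> 0) by apply Rgt_not_eq, exp_pos.
  destruct k; unfold sum_axis, christoffel, sum_axis; rewrite !partial_metric;
    simpl; field; auto.
Qed.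

(** [Sigma] is the Euler-Arnold field of the metric: in the frame [X, Y, Z] the geodesic equation
    becomes the first-order system [u' = Sigma alpha u]. *)
Lemma geodesic_of_left_velocity (alpha : R) (gamma u : R -> vec3) :
  is_integral_curve (Sigma alpha) u ->
  (forall s, has_velocity gamma s (frame alpha (gamma s) (u s))) ->
  is_geodesic alpha gamma.
Proof.
  intros Hu Hg.
  destruct (integral_curve_components _ _ Hu) as (Hx & Hy & Hz).
  assert (HA := fun s => Hg s ax); assert (HB := fun s => Hg s ay);
    assert (HC := fun s => Hg s az).
  simpl in Hx, Hy, Hz, HA, HB, HC.
  set (x := fun r => cx (u r)) in *; set (y := fun r => cy (u r)) in *;
    set (z := fun r => cz (u r)) in *.
  set (A := fun r => cx (gamma r)) in *; set (B := fun r => cy (gamma r)) in *;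
    set (C := fun r => cz (gamma r)) in *.
  (* The factor 2 arises because [x' = x z] and [C' = z] contribute the same term. *)
  assert (DA : forall s, is_derive (fun r => x r * exp (C r)) s
                           (2 * x s * z s * exp (C s))).
  { intro s; derive_by; unfold x, y, z, C; ring. }
  assert (DB : forall s, is_derive (fun r => y r * exp (- alpha * C r)) s
                           (-2 * alpha * y s * z s * exp (- alpha * C s))).
  { intro s; derive_by; unfold x, y, z, C; ring. }
  intros k s c.
  set (v := fun i => match i with
      ax => fun r => x r * exp (C r) | ay => fun r => y r * exp (- alpha * C r)
    | az => z end).
  assert (Hc : forall i r, is_derive (c i) r (v i r)).
  { intros [] r; [apply HA|apply HB|apply HC]. }
  assert (Hcv : forall i r, Derive (c i) r = v i r).
  { intros i r; apply is_derive_unique, Hc. }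
  set (l := match k with
      ax => 2 * x s * z s * exp (C s)
    | ay => -2 * alpha * y s * z s * exp (- alpha * C s)
    | az => alpha * (y s * (y s * 1)) - x s * (x s * 1) end).
  assert (Hl : is_derive (v k) s l) by (destruct k; [apply DA|apply DB|apply Hz]).
  split; [eexists; apply Hc|split].
  - exists l; apply (is_derive_ext (v k)); [intro; symmetry; apply Hcv|exact Hl].
  - rewrite (Derive_ext _ (v k)) by apply Hcv.
    rewrite (christoffel_sum alpha k (gamma s) (fun i => Derive (c i) s)).
    rewrite (is_derive_unique _ _ _ Hl), !Hcv; destruct k; unfold v, l.
    + ring.
    + ring.
    + simpl metric.
      change (cz (gamma s)) with (C s).
      (* The metric coefficients are the inverse squares of the frame factors in the velocity, so
         they cancel. *)
      replace (-2 * C s) with (- (C s + C s)) by ring.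
      replace (2 * alpha * C s) with (- (- alpha * C s + - alpha * C s)) by ring.
      rewrite !exp_Ropp, !exp_plus; field; split; apply Rgt_not_eq, exp_pos.
Qed.

Lemma left_velocity_of_geodesic (alpha : R) (gamma : R -> vec3) :
  is_geodesic alpha gamma ->
  exists u, is_integral_curve (Sigma alpha) u /\
    forall s, has_velocity gamma s (frame alpha (gamma s) (u s)).
Proof.
  intros Hg.
  set (A := fun r => cx (gamma r)); set (B := fun r => cy (gamma r));
    set (C := fun r => cz (gamma r)).
  assert (HA : forall s, is_derive A s (Derive A s)).
  { intro s; apply Derive_correct, (Hg ax s). }
  assert (HB : forall s, is_derive B s (Derive B s)).
  { intro s; apply Derive_correct, (Hg ay s). }
  assert (HC : forall s, is_derive C s (Derive C s)).
  { intro s; apply Derive_correct, (Hg az s). }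
  assert (HA' : forall s, is_derive (Derive A) s (2 * Derive A s * Derive C s)).
  { intro s; destruct (Hg ax s) as (_ & H & E).
    rewrite (christoffel_sum alpha ax (gamma s)
      (fun i => Derive (fun r => coord (gamma r) i) s)) in E.
    apply is_derive_value with (1 := Derive_correct _ _ H).
    unfold A, C; simpl in E |- *; lra. }
  assert (HB' : forall s, is_derive (Derive B) s (-2 * alpha * Derive B s * Derive C s)).
  { intro s; destruct (Hg ay s) as (_ & H & E).
    rewrite (christoffel_sum alpha ay (gamma s)
      (fun i => Derive (fun r => coord (gamma r) i) s)) in E.
    apply is_derive_value with (1 := Derive_correct _ _ H).
    unfold B, C; simpl in E |- *; lra. }
  assert (HC' : forall s, is_derive (Derive C) s
     (alpha * exp (2 * alpha * C s) * Derive B s ^ 2 - exp (-2 * C s) * Derive A s ^ 2)).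
  { intro s; destruct (Hg az s) as (_ & H & E).
    rewrite (christoffel_sum alpha az (gamma s)
      (fun i => Derive (fun r => coord (gamma r) i) s)) in E.
    apply is_derive_value with (1 := Derive_correct _ _ H).
    unfold A, B, C; simpl in E |- *; lra. }
  (* The velocity in frame coordinates: the frame factors [exp (C s)] and [exp (- alpha * C s)] are
     divided out. *)
  exists (fun s => mk3 (exp (- C s) * Derive A s) (exp (alpha * C s) * Derive B s)
                       (Derive C s)).
  split.
  - set (A' := Derive A) in *; set (B' := Derive B) in *; set (C' := Derive C) in *.
    intros s [].
    + change (is_derive (fun r => exp (- C r) * A' r) s (exp (- C s) * A' s * C' s)).
      derive_by; fold (C' s) (A' s); ring.
    + change (is_derive (fun r => exp (alpha * C r) * B' r) s
               (- alpha * (exp (alpha * C s) * B' s) * C' s)).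
      derive_by; ring.
    + eapply is_derive_value; [apply HC'|]; simpl.
      replace (-2 * C s) with (- C s + - C s) by ring.
      replace (2 * alpha * C s) with (alpha * C s + alpha * C s) by ring.
      rewrite !exp_plus; ring.
  - intros s i; destruct i; simpl; fold (C s).
    + apply (is_derive_value A) with (1 := HA s).
      rewrite exp_Ropp; field; apply Rgt_not_eq, exp_pos.
    + apply (is_derive_value B) with (1 := HB s).
      rewrite <- Ropp_mult_distr_l, exp_Ropp; field; apply Rgt_not_eq, exp_pos.
    + apply HC.
Qed.

(** The value chosen by [epsilon] is pinned down by uniqueness: a geodesic with the same initial
    velocity has the same left velocity, as both solve the [Sigma] system, and then the same
    coordinates by integration. *)
Lemma riem_exp_of_left_velocity (alpha : R) (gamma u : R -> vec3) :
  is_integral_curve (Sigma alpha) u ->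
  (forall s, has_velocity gamma s (frame alpha (gamma s) (u s))) ->
  gamma 0 = gid -> riem_exp alpha (u 0) = gamma 1.
Proof.
  intros Hu Hg H0.
  assert (Hex : exists q, riem_exp_rel alpha (u 0) q).
  { exists (gamma 1), gamma; split; [|split; [exact H0|split; [|reflexivity]]].
    - apply (geodesic_of_left_velocity alpha gamma u); auto.
    - rewrite <- H0; apply Hg. }
  destruct (epsilon_spec (inhabits gid) _ Hex) as (g & Gg & G0 & Gv & G1).
  fold (riem_exp alpha (u 0)) in G1; rewrite <- G1; clear G1 Hex.
  destruct (left_velocity_of_geodesic _ _ Gg) as (w & Hw & Hgw).
  assert (Hwu : forall s, w s = u s).
  { apply (Sigma_integral_curve_unique alpha w u 0 Hw Hu), vec3_eq; intro i.
    assert (E : coord (frame alpha gid (w 0)) i = coord (frame alpha gid (u 0)) i).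
    { rewrite <- (is_derive_unique _ _ _ (Gv i)); symmetry.
      rewrite <- G0; apply is_derive_unique, Hgw. }
    destruct i; simpl in E |- *; rewrite ?Rmult_0_r, ?exp_0, ?Rmult_1_r in E; exact E. }
  (* The third coordinate comes first because the frame at a point depends on it alone. *)
  assert (Hz : forall s, cz (g s) = cz (gamma s)).
  { apply (same_derivative_eq _ _ (fun s => cz (u s)) 0).
    - intro s; rewrite <- Hwu; apply (Hgw s az).
    - intro s; apply (Hg s az).
    - rewrite G0, H0; reflexivity. }
  apply vec3_eq; intros []; simpl; [| |apply Hz].
  - apply (same_derivative_eq (fun s => cx (g s)) (fun s => cx (gamma s))
             (fun s => cx (u s) * exp (cz (gamma s))) 0).
    + intro s; rewrite <- Hwu, <- Hz; apply (Hgw s ax).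
    + intro s; apply (Hg s ax).
    + rewrite G0, H0; reflexivity.
  - apply (same_derivative_eq (fun s => cy (g s)) (fun s => cy (gamma s))
             (fun s => cy (u s) * exp (- alpha * cz (gamma s))) 0).
    + intro s; rewrite <- Hwu, <- Hz; apply (Hgw s ay).
    + intro s; apply (Hg s ay).
    + rewrite G0, H0; reflexivity.
Qed.

(** * The curve Lambda_P *)

(** Integrating factor: [f * exp (- k * G)] is constant for [G] the integral of [g]. Applied to [x]
    and [y] with [g = z], it also yields their positivity. *)
Lemma linear_ode_exp (f g : R -> R) (k : R) :
  (forall s, ex_derive g s) -> (forall s, is_derive f s (k * f s * g s)) ->
  forall s, f s = f 0 * exp (k * RInt g 0 s).
Proof.
  intros Hg Hf s.
  pose proof (is_derive_RInt_0 g Hg) as HG; simpl in HG.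
  set (G := fun r => RInt g 0 r) in *; fold (G s).
  assert (H : f s * exp (- k * G s) = f 0 * exp (- k * G 0)).
  { apply (zero_derivative_const (fun r => f r * exp (- k * G r))); intro r.
    derive_by; ring. }
  replace (G 0) with 0 in H by (symmetry; apply (@RInt_point R_CompleteNormedModule)).
  rewrite Rmult_0_r, exp_0, Rmult_1_r in H; rewrite <- H.
  rewrite Rmult_assoc, <- exp_plus.
  replace (- k * G s + k * G s) with 0 by ring; rewrite exp_0; ring.
Qed.

(* With [W] the antiderivative of [z], left translating the integral curve
   [s |-> 2 t p(t - 2 t s)] gives a geodesic with third coordinate
   [W(t) - W(t - 2 t s)]; since [x] and [exp (- W)] are proportional, its first
   coordinate is the integral of [2 t x ^ 2 / x(t)], and similarly for the second. *)
Lemma Lambda_formula (alpha : R) (p : R -> vec3) (t : R) :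
  is_integral_curve (fun v => opp3 (Sigma alpha v)) p ->
  (forall s, p (- s) = reflect (p s)) ->
  0 < cx (p 0) -> 0 < cy (p 0) ->
  Lambda alpha p t =
  mk3 ((RInt (fun s => cx (p s) ^ 2) 0 t - RInt (fun s => cx (p s) ^ 2) 0 (- t)) / cx (p t))
      ((RInt (fun s => cy (p s) ^ 2) 0 t - RInt (fun s => cy (p s) ^ 2) 0 (- t)) / cy (p t))
      0.
Proof.
  intros Hp Hsym Hx0 Hy0.
  pose proof (backward_curve_reverse _ _ Hp) as Hrev.
  pose proof (Sigma_curve_rescale _ _ (2 * t) (- t) Hrev) as Hu.
  destruct (integral_curve_components _ _ Hp) as (Hx & Hy & Hz); simpl in Hx, Hy, Hz.
  set (x := fun s => cx (p s)) in *; set (y := fun s => cy (p s)) in *;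
    set (z := fun s => cz (p s)) in *.
  set (W := fun s => RInt z 0 s); set (X := fun s => RInt (fun r => x r ^ 2) 0 s);
    set (Y := fun s => RInt (fun r => y r ^ 2) 0 s).
  assert (HW : forall s, is_derive W s (z s)).
  { apply is_derive_RInt_0; intro s; eexists; apply Hz. }
  assert (HX : forall s, is_derive X s (x s ^ 2)).
  { apply (is_derive_RInt_0 (fun r => x r ^ 2)); intro s; auto_derive; eexists; apply Hx. }
  assert (HY : forall s, is_derive Y s (y s ^ 2)).
  { apply (is_derive_RInt_0 (fun r => y r ^ 2)); intro s; auto_derive; eexists; apply Hy. }
  assert (Ex : forall s, x s = x 0 * exp (-1 * W s)).
  { apply linear_ode_exp; [intro s; eexists; apply Hz|].
    intro s; eapply is_derive_value; [apply Hx|unfold x, z; ring]. }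
  assert (Ey : forall s, y s = y 0 * exp (alpha * W s)).
  { apply linear_ode_exp; [intro s; eexists; apply Hz|].
    intro s; eapply is_derive_value; [apply Hy|unfold y, z; ring]. }
  (* Evenness of [x] passes to [W] through the exponential; it makes the third coordinate vanish at
     time 1. *)
  assert (Wsym : W (- t) = W t).
  { assert (H : x (- t) = x t) by (unfold x; rewrite Hsym; reflexivity).
    rewrite (Ex t), (Ex (- t)) in H; apply Rmult_eq_reg_l in H; [|apply Rgt_not_eq, Hx0].
    apply exp_inv in H; lra. }
  assert (Hxt : x t <> 0).
  { rewrite Ex; apply Rgt_not_eq, Rmult_lt_0_compat; [apply Hx0|apply exp_pos]. }
  assert (Hyt : y t <> 0).
  { rewrite Ey; apply Rgt_not_eq, Rmult_lt_0_compat; [apply Hy0|apply exp_pos]. }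
  (* [tau] runs from [t] down to [- t] as [s] goes from 0 to 1. *)
  pose (tau := fun s => -2 * t * s + t).
  pose (gamma := fun s => mk3 ((X t - X (tau s)) / x t) ((Y t - Y (tau s)) / y t)
                              (W t - W (tau s))).
  assert (Htau : forall s, -1 * (2 * t * s + - t) + 0 = tau s).
  { intro s; unfold tau; ring. }
  unfold Lambda.
  replace (scal3 (2 * t) (p t))
    with (scal3 (2 * t) (p (-1 * (2 * t * 0 + - t) + 0))) by (do 2 f_equal; ring).
  rewrite (riem_exp_of_left_velocity alpha gamma _ Hu).
  - unfold gamma, tau; simpl.
    replace (-2 * t * 1 + t) with (- t) by ring.
    rewrite Wsym; f_equal; ring.
  - intros s i; rewrite Htau; destruct i; simpl.
    + eapply is_derive_value;
        [apply is_derive_const_minus_div, (is_derive_comp_affine X), HX|].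
      fold (tau s) (x (tau s)).
      (* This turns [x (tau s) ^ 2 / x t] into [x (tau s)] times the frame factor at [gamma s]. *)
      assert (E : x (tau s) = x t * exp (W t - W (tau s))).
      { rewrite (Ex t), (Ex (tau s)), Rmult_assoc, <- exp_plus; do 2 f_equal; ring. }
      rewrite E; field; exact Hxt.
    + eapply is_derive_value;
        [apply is_derive_const_minus_div, (is_derive_comp_affine Y), HY|].
      fold (tau s) (y (tau s)).
      assert (E : y (tau s) = y t * exp (- alpha * (W t - W (tau s)))).
      { rewrite (Ey t), (Ey (tau s)), Rmult_assoc, <- exp_plus; do 2 f_equal; ring. }
      rewrite E; field; exact Hyt.
    + eapply is_derive_value.
      (* Division by 1 brings the third coordinate under the rule used for the other two. *)
      * apply (is_derive_ext (fun r => (W t - W (tau r)) / 1)); [intro; apply Rdiv_1_r|].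
        apply is_derive_const_minus_div, (is_derive_comp_affine W), HW.
      * unfold z, tau; field.
  - unfold gamma, tau, gid; f_equal;
    replace (-2 * t * 0 + t) with t by ring; field; assumption.
Qed.

(** * Positivity up to the first zero, and interior points of a rectangle *)

Lemma pos_of_pos_derivative_at_zero (f : R -> R) (l t : R) :
  is_derive f 0 l -> 0 < l -> f 0 = 0 -> 0 < t -> exists s, 0 < s < t /\ 0 < f s.
Proof.
  intros Hd Hl H0 Ht; apply is_derive_Reals in Hd.
  (* Tolerance [l] itself: a difference quotient within [l] of [l] is positive. *)
  destruct (Hd l Hl) as [d Hdd]; pose proof (cond_pos d) as Hdpos.
  set (s := Rmin (d / 2) (t / 2)).
  assert (Hs : 0 < s <= d / 2 /\ s <= t / 2).
  { split; [split|]; [apply Rmin_glb_lt; lra|apply Rmin_l|apply Rmin_r]. }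
  exists s; split; [lra|].
  specialize (Hdd s); rewrite Rplus_0_l, H0, Rminus_0_r, (Rabs_pos_eq s) in Hdd by lra.
  specialize (Hdd ltac:(lra) ltac:(lra)).
  apply Rabs_def2 in Hdd.
  replace (f s) with (f s / s * s) by (field; lra).
  apply Rmult_lt_0_compat; lra.
Qed.

(** Some earlier point has a positive value, so a nonpositive value at [s] would force a zero in
    between. *)
Lemma pos_before_first_zero (f : R -> R) (l rho : R) :
  (forall s, ex_derive f s) -> is_derive f 0 l -> 0 < l -> f 0 = 0 ->
  (forall s, 0 < s < rho -> f s <> 0) -> forall s, 0 < s < rho -> 0 < f s.
Proof.
  intros Hf Hd Hl H0 Hne s Hs.
  destruct (pos_of_pos_derivative_at_zero f l s) as [r [Hr Hfr]]; try tauto.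
  destruct (Rlt_le_dec 0 (f s)) as [|Hfs]; [assumption|exfalso].
  assert (Hc : continuity f).
  { intro u; apply continuity_pt_filterlim.
    apply (@ex_derive_continuous R_AbsRing R_NormedModule), Hf. }
  destruct (IVT_cor f r s Hc) as [c [Hc1 Hc2]]; [lra|nra|].
  apply (Hne c); [lra|exact Hc2].
Qed.

Lemma plane_interior_rectangle (A B a b : R) :
  0 < a < A -> 0 < b < B -> plane_interior (rectangle A B) (mk3 a b 0).
Proof.
  intros Ha Hb; split; [reflexivity|]; simpl.
  (* The radius is the distance to the nearest side; balls of the product are squares. *)
  assert (Heps : 0 < Rmin (Rmin a (A - a)) (Rmin b (B - b))).
  { repeat apply Rmin_glb_lt; lra. }
  exists (mkposreal _ Heps); intros [u v] [Hu Hv]; simpl in Hu, Hv |- *.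
  pose proof (Rmin_l (Rmin a (A - a)) (Rmin b (B - b))).
  pose proof (Rmin_r (Rmin a (A - a)) (Rmin b (B - b))).
  pose proof (Rmin_l a (A - a)); pose proof (Rmin_r a (A - a)).
  pose proof (Rmin_l b (B - b)); pose proof (Rmin_r b (B - b)).
  apply Rabs_def2 in Hu; apply Rabs_def2 in Hv.
  unfold minus, plus, opp in Hu, Hv; simpl in Hu, Hv.
  assert (EA : u / A * A = u) by (field; lra).
  assert (EB : v / B * B = v) by (field; lra).
  exists (u / A), (v / B); repeat split.
  - apply Rdiv_le_0_compat; lra.
  - apply Rle_div_l; lra.
  - apply Rdiv_le_0_compat; lra.
  - apply Rle_div_l; lra.
  - rewrite EA, EB; reflexivity.
Qed.

(* With [h = 2 y^2 - alpha z G], [h' = alpha (2 y^2 z - z' G)]; when [z' > 0], the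
   bounds [G <= 2 t y^2] (as [y] increases) and [t z' <= z] (as [z] is concave) give
   [z' G <= 2 y^2 z], i.e. [h' >= 0]. *)
Lemma quotients_increasing (alpha rho : R) (x y z F G : R -> R) :
  0 < alpha ->
  (forall s, 0 < x s) -> (forall s, 0 < y s) -> z 0 = 0 ->
  (forall s, 0 < s < rho -> 0 < z s) ->
  (forall s, is_derive x s (- (x s * z s))) ->
  (forall s, is_derive y s (alpha * y s * z s)) ->
  (forall s, is_derive z s (x s ^ 2 - alpha * y s ^ 2)) ->
  (forall s, is_derive F s (2 * x s ^ 2)) ->
  (forall s, is_derive G s (2 * y s ^ 2)) ->
  F 0 = 0 -> G 0 = 0 ->
  forall t, 0 < t < rho -> 0 < F t / x t < F rho / x rho /\ 0 < G t / y t < G rho / y rho.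
Proof.
  intros Ha Hxp Hyp Hz0 Hzp Hx Hy Hz HF HG HF0 HG0.
  assert (HFp : forall s, 0 <= s -> 0 <= F s).
  { intros s Hs; rewrite <- HF0.
    apply (nonneg_derivative_le F (fun r => 2 * x r ^ 2)); auto.
    intros r _; specialize (Hxp r); nra. }
  assert (HGp : forall s, 0 <= s -> 0 <= G s).
  { intros s Hs; rewrite <- HG0.
    apply (nonneg_derivative_le G (fun r => 2 * y r ^ 2)); auto.
    intros r _; specialize (Hyp r); nra. }
  assert (HGy : forall s, 0 < s < rho -> G s <= 2 * s * y s ^ 2).
  { intros s Hs.
    assert (H : 2 * 0 * y 0 ^ 2 - G 0 <= 2 * s * y s ^ 2 - G s); [|rewrite HG0 in H; lra].
    apply (nonneg_derivative_le (fun r => 2 * r * y r ^ 2 - G r)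
             (fun r => 4 * alpha * (r * z r * y r ^ 2))); [lra| |].
    - intros r _; derive_by; ring.
    - intros r Hr; specialize (Hzp r ltac:(lra)).
      apply Rmult_le_pos; [lra|]. apply Rmult_le_pos; [nra|apply pow2_ge_0]. }
  (* Here [z'' = - 2 z (x^2 + alpha^2 y^2)], so [z - s z'] starts at 0 and has derivative
     [- s z'' >= 0]. *)
  assert (Hconcave : forall s, 0 < s < rho -> s * (x s ^ 2 - alpha * y s ^ 2) <= z s).
  { intros s Hs.
    assert (H : z 0 - 0 * (x 0 ^ 2 - alpha * y 0 ^ 2)
                <= z s - s * (x s ^ 2 - alpha * y s ^ 2)); [|rewrite Hz0 in H; lra].
    apply (nonneg_derivative_le (fun r => z r - r * (x r ^ 2 - alpha * y r ^ 2))
             (fun r => 2 * (r * z r * (x r ^ 2 + alpha ^ 2 * y r ^ 2)))); [lra| |].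
    - intros r _; derive_by; ring.
    - intros r Hr; specialize (Hzp r ltac:(lra)).
      apply Rmult_le_pos; [lra|]. apply Rmult_le_pos; [nra|].
      apply Rplus_le_le_0_compat; [|apply Rmult_le_pos]; apply pow2_ge_0. }
  assert (Hh : forall s, 0 < s < rho -> 0 < 2 * y s ^ 2 - alpha * z s * G s).
  { intros s Hs.
    apply Rlt_le_trans with (2 * y 0 ^ 2 - alpha * z 0 * G 0).
    { rewrite HG0; specialize (Hyp 0); nra. }
    apply (nonneg_derivative_le (fun r => 2 * y r ^ 2 - alpha * z r * G r)
             (fun r => alpha * (2 * y r ^ 2 * z r - (x r ^ 2 - alpha * y r ^ 2) * G r)));
      [lra| |].
    - intros r _; derive_by; ring.
    - intros r Hr; apply Rmult_le_pos; [lra|].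
      specialize (HGp r ltac:(lra)); specialize (HGy r ltac:(lra)).
      specialize (Hconcave r ltac:(lra)); specialize (Hzp r ltac:(lra)).
      pose proof (pow2_ge_0 (y r)) as Hy2.
      set (z' := x r ^ 2 - alpha * y r ^ 2) in *.
      (* If [z' < 0], both [2 y^2 z] and [- z' G] are nonnegative already. *)
      destruct (Rle_dec 0 z') as [Hz'|Hz'].
      + pose proof (Rmult_le_compat_l _ _ _ Hz' HGy).
        pose proof (Rmult_le_compat_l _ _ _ Hy2 Hconcave). nra.
      + pose proof (Rmult_le_pos _ _ Hy2 (Rlt_le _ _ Hzp)). nra. }
  assert (Hxinv : forall s, x s <> 0) by (intro s; apply Rgt_not_eq, Hxp).
  assert (Hyinv : forall s, y s <> 0) by (intro s; apply Rgt_not_eq, Hyp).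
  (* Positivity of the derivative is required only inside the interval, so the endpoints 0 and [rho]
     are included. *)
  assert (HFx : forall s r, 0 <= s < r -> r <= rho -> F s / x s < F r / x r).
  { intros s r Hs Hr.
    apply (pos_derivative_lt (fun u => F u / x u) (fun u => 2 * x u + F u * z u / x u));
      [lra| |].
    - intros u _; derive_by; auto; field; auto.
    - intros u Hu; apply Rplus_lt_le_0_compat; [specialize (Hxp u); lra|].
      apply Rdiv_le_0_compat; [|apply Hxp].
      apply Rmult_le_pos; [apply HFp; lra|apply Rlt_le, Hzp; lra]. }
  (* Since [y' = alpha y z], the derivative of [G / y] is the quantity of [Hh] divided by [y]. *)
  assert (HGy' : forall s r, 0 <= s < r -> r <= rho -> G s / y s < G r / y r).
  { intros s r Hs Hr.
    apply (pos_derivative_lt (fun u => G u / y u)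
             (fun u => (2 * y u ^ 2 - alpha * z u * G u) / y u)); [lra| |].
    - intros u _; derive_by; auto; field; auto.
    - intros u Hu; apply Rdiv_lt_0_compat; [apply Hh; lra|apply Hyp]. }
  intros t Ht; split; split; try (apply HFx || apply HGy'; lra).
  (* Positivity is the same monotonicity started at 0, where the quotient vanishes. *)
  - replace 0 with (F 0 / x 0) by (rewrite HF0; unfold Rdiv; ring); apply HFx; lra.
  - replace 0 with (G 0 / y 0) by (rewrite HG0; unfold Rdiv; ring); apply HGy'; lra.
Qed.

(** * Integrals over symmetric intervals, and the inclusion in the rectangle *)

Lemma is_derive_RInt_symmetric (f : R -> R) :
  (forall s, ex_derive f s) -> (forall s, f (- s) = f s) ->
  forall s, is_derive (fun u => RInt f 0 u - RInt f 0 (- u)) s (2 * f s).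
Proof.
  intros Hf Heven s.
  pose proof (is_derive_RInt_0 f Hf) as HF; simpl in HF.
  set (F := fun u => RInt f 0 u) in *.
  change (is_derive (fun u => F u - F (- u)) s (2 * f s)).
  derive_by; rewrite Heven; ring.
Qed.

Theorem theorem3p18
  (alpha x0 P : R) (sigma p : R -> vec3)
  (Halpha : 0 < alpha <= 1)
  (Hx0 : sqrt (alpha / (1 + alpha)) < x0 < 1)
  (Hsigma : is_integral_curve (Sigma alpha) sigma)
  (Hsigma0 : sigma 0 = base_point x0)
  (HP : is_minimal_period sigma P)
  (Hp : is_integral_curve (fun v => opp3 (Sigma alpha v)) p)
  (Hp0 : p 0 = base_point x0) :
  let rho := P / 2 in
  let B_P := rectangle (cx (Lambda alpha p rho)) (cy (Lambda alpha p rho)) in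
  forall t : R, 0 < t < rho -> plane_interior B_P (Lambda alpha p t).
Proof.
  intros rho B_P t Ht.
  assert (Hx0pos : 0 < x0) by (pose proof (sqrt_pos (alpha / (1 + alpha))); lra).
  (* With [y0 ^ 2 = 1 - x0 ^ 2] this says [x0 ^ 2 - alpha * y0 ^ 2 > 0], i.e. that [z] has positive
     derivative at 0. *)
  assert (Hx0sq : alpha < x0 ^ 2 * (1 + alpha)).
  { assert (Hq : 0 <= alpha / (1 + alpha)) by (apply Rdiv_le_0_compat; lra).
    pose proof (pow2_sqrt _ Hq) as Hsq; pose proof (sqrt_pos (alpha / (1 + alpha))).
    apply Rlt_div_l; [lra|]; nra. }
  set (y0 := sqrt (1 - x0 ^ 2)) in *.
  assert (Hy0sq : y0 ^ 2 = 1 - x0 ^ 2) by (apply pow2_sqrt; nra).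
  assert (Hy0pos : 0 < y0) by (apply sqrt_lt_R0; nra).
  (* Uniqueness identifies [p] with [sigma] run backward, so the minimal period of [sigma]
     constrains the zeros of [z] along [p]. *)
  assert (Hps : forall s, p (- s) = sigma s).
  { intro s; replace (- s) with (-1 * s + 0) by ring.
    apply (Sigma_integral_curve_unique alpha (fun r => p (-1 * r + 0)) sigma 0);
      [apply backward_curve_reverse, Hp|exact Hsigma|].
    rewrite Hsigma0, <- Hp0; f_equal; ring. }
  assert (Hz0 : cz (sigma 0) = 0) by (rewrite Hsigma0; reflexivity).
  assert (Hsym : forall s, p (- s) = reflect (p s)).
  { intro s; rewrite Hps, <- (Ropp_involutive s), Hps, Ropp_involutive.
    rewrite <- (Rplus_0_l s), (Sigma_curve_symmetric alpha sigma 0 Hsigma Hz0).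
    do 2 f_equal; ring. }
  unfold B_P; rewrite !(Lambda_formula alpha p _ Hp Hsym)
    by (rewrite Hp0; assumption); simpl.
  destruct (integral_curve_components _ _ Hp) as (Hx & Hy & Hz); simpl in Hx, Hy, Hz.
  set (x := fun s => cx (p s)) in *; set (y := fun s => cy (p s)) in *;
    set (z := fun s => cz (p s)) in *.
  assert (Hexz : forall s, ex_derive z s) by (intro s; eexists; apply Hz).
  assert (Hxpos : forall s, 0 < x s).
  { intro s; rewrite (linear_ode_exp x z (-1) Hexz).
    - unfold x; rewrite Hp0; apply Rmult_lt_0_compat; [exact Hx0pos|apply exp_pos].
    - intro r; eapply is_derive_value; [apply Hx|unfold x, z; ring]. }
  assert (Hypos : forall s, 0 < y s).
  { intro s; rewrite (linear_ode_exp y z alpha Hexz).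
    - unfold y; rewrite Hp0; apply Rmult_lt_0_compat; [exact Hy0pos|apply exp_pos].
    - intro r; eapply is_derive_value; [apply Hy|unfold y, z; ring]. }
  assert (Hz0' : z 0 = 0) by (unfold z; rewrite Hp0; reflexivity).
  assert (Hzpos : forall s, 0 < s < rho -> 0 < z s).
  { apply (pos_before_first_zero z _ rho Hexz (Hz 0)); [|exact Hz0'|].
    - rewrite Hp0; change (0 < - (alpha * y0 ^ 2 - x0 ^ 2)); rewrite Hy0sq; lra.
    - intros s Hs Hzs.
      assert (Hzs' : cz (sigma s) = 0).
      { rewrite <- Hps, Hsym; simpl; fold (z s); lra. }
      pose proof (proj2 HP _ (Sigma_curve_period alpha sigma s Hsigma Hz0 Hzs' (proj1 Hs))).
      unfold rho in Hs; lra. }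
  assert (Hxsym : forall s, x (- s) = x s) by (intro s; unfold x; rewrite Hsym; reflexivity).
  assert (Hysym : forall s, y (- s) = y s) by (intro s; unfold y; rewrite Hsym; reflexivity).
  set (F := fun s => RInt (fun r => x r ^ 2) 0 s - RInt (fun r => x r ^ 2) 0 (- s)).
  set (G := fun s => RInt (fun r => y r ^ 2) 0 s - RInt (fun r => y r ^ 2) 0 (- s)).
  assert (HF : forall s, is_derive F s (2 * x s ^ 2)).
  { apply (is_derive_RInt_symmetric (fun r => x r ^ 2)).
    - intro s; auto_derive; eexists; apply Hx.
    - intro s; rewrite Hxsym; reflexivity. }
  assert (HG : forall s, is_derive G s (2 * y s ^ 2)).
  { apply (is_derive_RInt_symmetric (fun r => y r ^ 2)).
    - intro s; auto_derive; eexists; apply Hy.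
    - intro s; rewrite Hysym; reflexivity. }
  assert (HF0 : F 0 = 0) by (unfold F; rewrite Ropp_0; apply Rminus_diag).
  assert (HG0 : G 0 = 0) by (unfold G; rewrite Ropp_0; apply Rminus_diag).
  assert (Hq : 0 < F t / x t < F rho / x rho /\ 0 < G t / y t < G rho / y rho).
  { apply (quotients_increasing alpha rho x y z F G); try assumption; [apply Halpha| |].
    - intro s; eapply is_derive_value; [apply Hy|unfold y, z; ring].
    - intro s; eapply is_derive_value; [apply Hz|unfold x, y; ring]. }
  apply plane_interior_rectangle; apply Hq.
Qed.
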